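(* Let $t > 1$ be an integer, and let $P_t(q) := \sum_{n \ge 1} p(n,t)\, q^n$, where $p(n,t)$ is the number of partitions of $n$ with difference $t$ between largest and smallest parts. Then $$P_t(q) = \frac{q^{t-1}(1-q)}{(1-q^t)(1-q^{t-1})} - \frac{q^{t-1}(1-q)}{(1-q^t)(1-q^{t-1})\,(q)_t} + \frac{q^t}{(1-q^{t-1})\,(q)_t},$$ where $(q)_t := (1-q)(1-q^2)\cdots(1-q^t)$.
   Context: A partition of a positive integer $n$ is an integer $k$-tuple $\lambda_1 \ge \lambda_2 \ge \dots \ge \lambda_k > 0$, for some $k\ge 1$, with $n = \lambda_1 + \dots + \lambda_k$; the $\lambda_i$ are its parts. For an integer $t \ge 0$, $p(n,t)$ denotes the number of partitions of $n$ with $\lambda_1 - \lambda_k = t$. The identity is an identity of formal power series in $q$, rational functions being expanded at $q=0$. *)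

(* Defs.v *)
From HB Require Import structures.
From mathcomp Require Import all_boot all_order all_algebra.
From mathcomp Require Import finmap.
From mathcomp Require Import boolp classical_sets functions cardinality.

Set Implicit Arguments.
Unset Strict Implicit.
Unset Printing Implicit Defensive.

Import GRing.Theory.

Local Open Scope ring_scope.

Record fps (R : Type) := FPS { fps_coef : nat -> R }.

Notation "f ``_ n" := (fps_coef f n)
  (at level 3, n at level 2, left associativity, format "f ``_ n") : ring_scope.

Lemma fpsP (R : Type) (f g : fps R) : (forall n, f``_n = g``_n) -> f = g.
Proof. by case: f g => [f] [g] /= fg; congr FPS; apply: funext. Qed.

HB.instance Definition _ (R : Type) := gen_eqMixin (fps R).
HB.instance Definition _ (R : Type) := gen_choiceMixin (fps R).

Section Zmodule.
Variable R : zmodType.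
Implicit Types f g : fps R.

Definition fps_zero : fps R := FPS (fun=> 0).
Definition fps_opp f : fps R := FPS (fun n => - f``_n).
Definition fps_add f g : fps R := FPS (fun n => f``_n + g``_n).

Fact fps_addA : associative fps_add.
Proof. by move=> f g h; apply: fpsP => n; apply: addrA. Qed.
Fact fps_addC : commutative fps_add.
Proof. by move=> f g; apply: fpsP => n; apply: addrC. Qed.
Fact fps_add0 : left_id fps_zero fps_add.
Proof. by move=> f; apply: fpsP => n; apply: add0r. Qed.
Fact fps_addN : left_inverse fps_zero fps_opp fps_add.
Proof. by move=> f; apply: fpsP => n; apply: addNr. Qed.

HB.instance Definition _ :=
  GRing.isZmodule.Build (fps R) fps_addA fps_addC fps_add0 fps_addN.

End Zmodule.

Section Ring.
Variable R : comNzRingType.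
Implicit Types f g h : fps R.

Definition fps_one : fps R := FPS (fun n => (n == 0%N)%:R).
Definition fps_mul f g : fps R :=
  FPS (fun n => \sum_(i < n.+1) f``_i * g``_(n - i)).

Let trunc n f : {poly R} := \poly_(i < n.+1) f``_i.

Let coef_trunc n f i : (i <= n)%N -> (trunc n f)`_i = f``_i.
Proof. by move=> le_in; rewrite coef_poly ltnS le_in. Qed.

Let coef_truncM n f g i : (i <= n)%N ->
  (trunc n f * trunc n g)`_i = (fps_mul f g)``_i.
Proof.
move=> le_in; rewrite coefM; apply: eq_bigr => j _.
rewrite !coef_trunc // ?(leq_trans (leq_subr _ _)) //.
by rewrite (leq_trans _ le_in) // -ltnS.
Qed.

Fact fps_mulC : commutative fps_mul.
Proof.
move=> f g; apply: fpsP => n.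
by rewrite -!(@coef_truncM n) // mulrC.
Qed.

Fact fps_mulA : associative fps_mul.
Proof.
move=> f g h; apply: fpsP => n.
transitivity ((trunc n f * (trunc n g * trunc n h))`_n).
  rewrite coefM; apply: eq_bigr => j _.
  by rewrite coef_truncM ?leq_subr // coef_trunc // -ltnS.
rewrite mulrA coefM; apply: eq_bigr => j _.
by rewrite coef_truncM ?coef_trunc ?leq_subr // -ltnS.
Qed.

Fact fps_mul1 : left_id fps_one fps_mul.
Proof.
move=> f; apply: fpsP => n /=.
by rewrite big_ord_recl /= mul1r subn0 big1 ?addr0 // => i _; rewrite mul0r.
Qed.

Fact fps_mulDl : left_distributive fps_mul (@fps_add R).
Proof.
move=> f g h; apply: fpsP => n /=.
by rewrite -big_split /=; apply: eq_bigr => i _; rewrite mulrDl.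
Qed.

Fact fps_oner_neq0 : fps_one != 0.
Proof.
by apply/eqP => /(congr1 (fun f => f``_0%N)) /= /eqP; rewrite oner_eq0.
Qed.

HB.instance Definition _ := GRing.Zmodule_isComNzRing.Build (fps R)
  fps_mulA fps_mulC fps_mul1 fps_mulDl fps_oner_neq0.

Lemma fps_coefM f g n : (f * g)``_n = \sum_(i < n.+1) f``_i * g``_(n - i).
Proof. by []. Qed.

Lemma fps_coef1 n : (1 : fps R)``_n = (n == 0%N)%:R.
Proof. by []. Qed.

End Ring.

Section UnitRing.
Variable R : comUnitRingType.
Implicit Types f g : fps R.

(* The list of the coefficients of 1/f up to degree n, from the recurrence
   f_0 g_0 = 1 and f_0 g_m = - (f_1 g_(m-1) + ... + f_m g_0). *)
Fixpoint fps_inv_seq f n : seq R :=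
  if n is m.+1 then
    let s := fps_inv_seq f m in
    rcons s (- (f``_0%N)^-1 * \sum_(i < m.+1) f``_i.+1 * s`_(m - i))
  else [:: (f``_0%N)^-1].

Definition fps_unit : pred (fps R) := [pred f | f``_0%N \is a GRing.unit].

(* As usual for the total inverse of a unitRingType, non-units are fixed. *)
Definition fps_inv f : fps R :=
  if fps_unit f then FPS (fun n => (fps_inv_seq f n)`_n) else f.

Let size_inv_seq f n : size (fps_inv_seq f n) = n.+1.
Proof. by elim: n => //= n IHn; rewrite size_rcons IHn. Qed.

Let nth_inv_seq f n i : (i <= n)%N ->
  (fps_inv_seq f n)`_i = (fps_inv_seq f i)`_i.
Proof.
elim: n => [|n IHn]; first by case: i.
rewrite leq_eqVlt => /predU1P[-> //|lt_in] /=.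
by rewrite nth_rcons size_inv_seq lt_in IHn.
Qed.

Fact fps_mulVf : {in fps_unit, left_inverse 1 fps_inv *%R}.
Proof.
move=> f; rewrite /fps_inv unfold_in => f0U; rewrite (f0U : fps_unit f).
rewrite mulrC; apply: fpsP => -[|m]; rewrite fps_coefM fps_coef1.
  by rewrite big_ord1 /= divrr.
rewrite big_ord_recl /= nth_rcons size_inv_seq ltnn eqxx mulrA mulrN divrr //.
rewrite mulN1r; apply/eqP; rewrite addrC subr_eq0; apply/eqP.
by apply: eq_bigr => i _; rewrite /bump add1n subSS -(nth_inv_seq f (leq_subr i m)).
Qed.

Fact fps_unitP f g : g * f = 1 -> fps_unit f.
Proof.
move/(congr1 (fun h => h``_0%N)); rewrite fps_coefM big_ord1 fps_coef1 => gf1.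
by apply/unitrPr; exists g``_0%N; rewrite mulrC.
Qed.

Fact fps_inv_out : {in [predC fps_unit], fps_inv =1 id}.
Proof. by move=> f; rewrite /fps_inv !inE => /negPf fN; rewrite [fps_unit f]fN. Qed.

HB.instance Definition _ :=
  GRing.ComNzRing_hasMulInverse.Build (fps R) fps_mulVf fps_unitP fps_inv_out.

Lemma fps_unitE f : (f \is a GRing.unit) = (f``_0%N \is a GRing.unit).
Proof. by []. Qed.

End UnitRing.

Definition fpsX (R : nzRingType) : fps R := FPS (fun n => (n == 1%N)%:R).

Definition qpoch (R : comUnitRingType) (q : fps R) (t : nat) : fps R :=
  \prod_(1 <= i < t.+1) (1 - q ^+ i).

Local Open Scope nat_scope.

(* The partition is the list of its parts, in weakly decreasing order. *)
Definition is_partition (n : nat) (l : seq nat) : bool :=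
  [&& l != [::], sorted geq l, all (ltn 0) l & sumn l == n].

(* As l is weakly decreasing, the subtraction does not truncate. *)
Definition partitions_diff (n t : nat) : set (seq nat) :=
  [set l | is_partition n l /\ head 0 l - last 0 l = t].

Lemma finite_partitions_diff n t : finite_set (partitions_diff n t).
Proof.
apply: (@sub_finite_set _ _
  [set` [seq map val (b : seq 'I_n.+1) | b : {bseq n of 'I_n.+1}]]); last first.
  exact: finite_seq.
move=> l [/and4P[_ _ l_gt0 /eqP sum_l] _] /=; apply/mapP.
have le_l x : x \in l -> x <= n.
  move=> xl; rewrite -sum_l sumnE (perm_big _ (perm_to_rem xl)) big_cons.
  exact: leq_addr.
have size_l : size l <= n.
  rewrite -sum_l; elim: l l_gt0 {sum_l le_l} => //= x l IHl /andP[x0 /IHl].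
  by move=> le_l; rewrite -add1n leq_add.
have size_b : size (map (@inord n) l) <= n by rewrite size_map.
exists (Bseq size_b); first by rewrite mem_enum.
rewrite /= -map_comp -[LHS]map_id; apply/eq_in_map => x xl.
by rewrite /= inordK // ltnS le_l.
Qed.

(* By finite_partitions_diff, fset_set does not take its default value. *)
Definition num_partitions_diff (n t : nat) : nat :=
  #|` fset_set (partitions_diff n t)|.

Definition gf_partitions_diff (R : nzRingType) (t : nat) : fps R :=
  FPS (fun n => if 1 <= n then (num_partitions_diff n t)%:R%R else 0%R).

(* Main.v *)
(** Splitting off the partitions with smallest part [m] (hence largest part
    [m + t]) gives
      P_t(q) = \sum_(m >= 1) q^(2m+t) / ((1 - q^m) ... (1 - q^(m+t))).
    With [x = q^m] and [(x)_t = (1 - x) (1 - xq) ... (1 - xq^(t-1))] this sum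
    telescopes: its [m]-th term is [G(x) - G(xq)] for [G(x) = (a + b x) / (x)_t],
    [b = q^(t-1) / (1 - q^(t-1))] and [a = - b (1 - q) / (1 - q^t)].  Hence
    [P_t = G(q) - a], as [G(q^m)] tends to [a] when [m] grows. *)
Require Import Defs.
From mathcomp Require Import all_boot all_order all_algebra.
From mathcomp Require Import finmap.
From mathcomp Require Import boolp classical_sets functions cardinality.
From mathcomp Require Import zify ring.

Set Implicit Arguments.
Unset Strict Implicit.
Unset Printing Implicit Defensive.

Import GRing.Theory.

Local Open Scope ring_scope.

(** * Power series: products of [(1 - q ^+ i)^-1] and telescoping *)

Section PowerSeries.
Variable R : comUnitRingType.
Local Notation q := (fpsX R).

Lemma coef_XM (f : fps R) n : (q * f)``_n = if n is m.+1 then f``_m else 0.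
Proof.
rewrite fps_coefM; case: n => [|n]; first by rewrite big_ord1 mul0r.
rewrite 2!big_ord_recl /= mul0r add0r mul1r subSS subn0 big1 ?addr0 //.
by move=> i _; rewrite mul0r.
Qed.

Lemma coef_XnM k (f : fps R) n :
  (q ^+ k * f)``_n = if (k <= n)%N then f``_(n - k) else 0.
Proof.
elim: k n => [|k IHk] n; first by rewrite expr0 mul1r subn0.
by rewrite exprS -mulrA coef_XM; case: n => // n; rewrite IHk.
Qed.

Lemma coefXn k n : (q ^+ k)``_n = (n == k)%:R.
Proof.
rewrite -[q ^+ k]mulr1 coef_XnM fps_coef1 subn_eq0 eqn_leq.
by case: (k <= n)%N; rewrite ?andbF ?andbT.
Qed.

Lemma unit_1subXn k : (0 < k)%N -> 1 - q ^+ k \is a GRing.unit.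
Proof.
by case: k => // k _; rewrite fps_unitE /= coefXn subr0 unitr1.
Qed.

(* [1 / (x)_k] for [x = q^a] *)
Definition inv_poch a k : fps R := \prod_(a <= i < a + k) (1 - q ^+ i)^-1.

Lemma inv_pochSr a k : (0 < a)%N ->
  inv_poch a k.+1 * (1 - q ^+ (a + k)) = inv_poch a k.
Proof.
move=> a0; rewrite /inv_poch addnS big_nat_recr ?leq_addr //=.
by rewrite divrK // unit_1subXn // addn_gt0 a0.
Qed.

Lemma inv_pochSl a k : (0 < a)%N ->
  inv_poch a k.+1 * (1 - q ^+ a) = inv_poch a.+1 k.
Proof.
move=> a0; rewrite /inv_poch addnS big_ltn ?ltnS ?leq_addr //.
by rewrite mulrC mulrA divrr ?mul1r ?addSn // unit_1subXn.
Qed.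

(** Each new factor changes the product by a multiple of [q ^+ a]. Hence the coefficients below
    degree [a] are those of [1], which is what the limit of [G(q^m)] needs. *)
Lemma inv_poch_eq1_mod a k : (0 < a)%N ->
  exists h, inv_poch a k = 1 + q ^+ a * h.
Proof.
move=> a0; elim: k => [|k [h IHk]].
  by exists 0; rewrite /inv_poch addn0 big_geq // mulr0 addr0.
exists (h + q ^+ k * inv_poch a k.+1).
rewrite mulrDr addrA -IHk mulrA -exprD -(inv_pochSr k a0); ring.
Qed.

Lemma unit_qpoch t : qpoch q t \is a GRing.unit.
Proof.
rewrite /qpoch big_nat; apply: rpred_prod => i /andP[i0 _].
exact: unit_1subXn.
Qed.

Lemma qpochV t : inv_poch 1 t = (qpoch q t)^-1.
Proof.
rewrite /inv_poch /qpoch add1n; elim: t => [|t IHt].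
  by rewrite !big_geq // invr1.
rewrite big_nat_recr //= IHt [in RHS]big_nat_recr //=.
by rewrite invrM ?unit_1subXn 1?mulrC //; apply: unit_qpoch.
Qed.

(* The numerator [a + b x] is the only one of degree 1 in [x] that works:
   [(a + b x) (1 - x q^t) - (a + b x q) (1 - x)] has constant term [0] and
   must equal [q^t x^2]. *)
Lemma telescope_term t m (a b : fps R) : (0 < m)%N ->
  a * (1 - q ^+ t) + b * (1 - q) = 0 -> b * (q - q ^+ t) = q ^+ t ->
  (a + b * q ^+ m) * inv_poch m t - (a + b * q ^+ m.+1) * inv_poch m.+1 t =
  q ^+ (m + t + m) * inv_poch m t.+1.
Proof.
move=> m0 ab bq; rewrite -(inv_pochSr t m0) -(inv_pochSl t m0).
rewrite !exprD exprS; set x := q ^+ m; set F := inv_poch _ _.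
(* Collected by powers of [x], the numerator has the left sides of [ab] and [bq] as its
   coefficients. *)
transitivity (F * (x * (a * (1 - q ^+ t) + b * (1 - q))
                   + x ^+ 2 * (b * (q - q ^+ t)))); first ring.
by rewrite ab bq; ring.
Qed.

(** The passage to the limit, one coefficient at a time: for [m = n.+1], both [P m] and [G(q^m) - a]
    vanish in degree [n]. *)
Lemma const_tail (P : nat -> fps R) (a b c : fps R) t :
  (forall m n, (n < m)%N -> (P m)``_n = 0) ->
  (forall m, (0 < m)%N -> P m - (a + b * q ^+ m) * inv_poch m t = c) ->
  c = - a.
Proof.
move=> P0 Pc; apply: fpsP => n; rewrite -(Pc n.+1) //.
have [h ->] := inv_poch_eq1_mod t (ltn0Sn n).
have -> : P n.+1 - (a + b * q ^+ n.+1) * (1 + q ^+ n.+1 * h) =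
    P n.+1 - a - q ^+ n.+1 * (b + (a + b * q ^+ n.+1) * h) by ring.
transitivity ((P n.+1)``_n - a``_n
    - (q ^+ n.+1 * (b + (a + b * q ^+ n.+1) * h))``_n); first by [].
by rewrite P0 // coef_XnM ltnn subr0 sub0r.
Qed.

End PowerSeries.

(** * Generating functions of sets of partitions, by weight *)

Local Open Scope classical_set_scope.

Definition positive_decreasing : set (seq nat) :=
  [set l | sorted geq l && all (ltn 0) l].

Definition weight_class (A : set (seq nat)) n := A `&` [set l | sumn l = n].

(** The difference of the extreme parts is at most the weight, so the empty list and finitely many
    finite sets cover the class. Finiteness keeps [fset_set] off its default value. *)
Lemma finite_weight_class A n : A `<=` positive_decreasing ->
  finite_set (weight_class A n).
Proof.
move=> Apos; apply: (@sub_finite_set _ _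
  ([set [::]] `|` \bigcup_(t in `I_n.+1) partitions_diff n t)); last first.
  rewrite finite_setU; split; first exact: finite_set1.
  apply: bigcup_finite => [|t _]; first exact: finite_II.
  exact: finite_partitions_diff.
move=> l [/Apos /andP[l_sorted l_pos] /= l_n].
case: l l_sorted l_pos l_n => [|x l] l_sorted l_pos l_n; [by left|right].
exists (x - last x l)%N => /=.
  by rewrite ltnS (leq_trans (leq_subr _ _)) // -l_n leq_addr.
by split=> //; rewrite /is_partition l_sorted l_pos l_n eqxx.
Qed.

Section GeneratingFunction.
Variable R : comUnitRingType.
Local Notation q := (fpsX R).

Definition gf (A : set (seq nat)) : fps R :=
  FPS (fun n => (#|` fset_set (weight_class A n)|)%:R).

Lemma gfU A B : A `<=` positive_decreasing -> B `<=` positive_decreasing ->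
  A `&` B = set0 -> gf (A `|` B) = gf A + gf B.
Proof.
move=> Apos Bpos AB0; apply: fpsP => n /=.
have finA := finite_weight_class n Apos.
have finB := finite_weight_class n Bpos.
rewrite /weight_class setIUl fset_setU // cardfsU -fset_setI //.
by rewrite setIACA AB0 set0I fset_set0 cardfs0 subn0 natrD.
Qed.

(** The map carries the class of weight [n - d] bijectively onto that of weight [n], which is empty
    for [n < d]. *)
Lemma gf_image (f : seq nat -> seq nat) d A :
  A `<=` positive_decreasing -> injective f ->
  (forall l, sumn (f l) = d + sumn l)%N -> gf (f @` A) = q ^+ d * gf A.
Proof.
move=> Apos f_inj f_sum; apply: fpsP => n; rewrite coef_XnM /=.
case: leqP => [le_dn|lt_nd]; last first.
  rewrite [weight_class _ _](_ : _ = set0) ?fset_set0 ?cardfs0 //.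
  by rewrite -subset0 => _ [[l _ <-] /= fl]; move: lt_nd; rewrite -fl f_sum; lia.
rewrite [weight_class _ _](_ : _ = f @` weight_class A (n - d)).
  by rewrite fset_set_image ?card_imfset //; apply: finite_weight_class.
apply/seteqP; split => [_ [[l Al <-] /= fl]|_ [l [Al /= l_n] <-]].
  by exists l => //; split=> //=; move: fl; rewrite f_sum; lia.
by split; [exists l|rewrite /= f_sum l_n subnKC].
Qed.

End GeneratingFunction.

(** * Partitions with parts in an interval *)

Definition parts_between a k : set (seq nat) :=
  [set l | sorted geq l && all (fun x => a <= x < a + k)%N l].

Lemma parts_between_sub a k : (0 < a)%N ->
  parts_between a k `<=` positive_decreasing.
Proof.
move=> a0 l /andP[l_sorted l_in]; apply/andP; split=> //.
by apply: sub_all l_in => x /andP[+ _]; apply: leq_trans.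
Qed.

Lemma geq_trans : transitive geq.
Proof. by move=> x y z /= yx zy; apply: leq_trans yx. Qed.

(** Either the largest allowed part [a + k] does not occur, or it is the head and removing it leaves
    a list of the same kind. *)
Lemma parts_betweenS a k :
  parts_between a k.+1 =
  parts_between a k `|` cons (a + k)%N @` parts_between a k.+1.
Proof.
apply/seteqP; split => l.
  case: l => [|x l] /andP[]; first by left.
  rewrite /= (path_sortedE geq_trans).
  move=> /andP[le_x l_sorted] /andP[x_in l_in].
  have [x_max|x_lt] := eqVneq x (a + k)%N.
    by right; exists l; [apply/andP|rewrite x_max].
  left; rewrite /parts_between /= (path_sortedE geq_trans) le_x l_sorted /=.
  apply/andP; split; first by lia.
  apply/allP => y yl; move/allP: le_x => /(_ y yl) /=.
  by move/allP: l_in => /(_ y yl); lia.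
case=> [/andP[l_sorted l_in]|[l' /andP[l_sorted l_in] <-]].
  by apply/andP; split=> //; apply: sub_all l_in => x; lia.
apply/andP; rewrite /= (path_sortedE geq_trans) l_sorted l_in !andbT.
split; last by lia.
by apply: sub_all l_in => x /=; lia.
Qed.

(** Splitting by the largest allowed part gives a linear equation for the series, solved by
    cancelling the unit [1 - q ^+ (a + k)]. *)
Lemma gf_parts_between (R : comUnitRingType) a k : (0 < a)%N ->
  gf R (parts_between a k) = inv_poch R a k.
Proof.
move=> a0; elim: k => [|k IHk].
  rewrite /inv_poch addn0 big_geq //; apply: fpsP => n /=.
  (* No part is allowed, so only the empty list remains, of weight 0. *)
  have -> : weight_class (parts_between a 0) n =
      if n == 0%N then [set [::]] else set0.
    apply/seteqP; split => [[|x l] [/= /andP[_]] /=|l].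
    - by move=> _ <-.
    - by rewrite addn0 => /andP[]; lia.
    - by case: eqP => // -> ->.
  by case: eqP; rewrite ?fset_set1 ?cardfs1 ?fset_set0 ?cardfs0.
have ak0 : (0 < a + k)%N by lia.
have S1 := @parts_between_sub a k.+1 a0.
have recF : gf R (parts_between a k.+1) =
    inv_poch R a k + fpsX R ^+ (a + k) * gf R (parts_between a k.+1).
  have gfE : gf R (cons (a + k)%N @` parts_between a k.+1) =
      fpsX R ^+ (a + k) * gf R (parts_between a k.+1).
    by apply: gf_image => // l l' [].
  rewrite -gfE {1}parts_betweenS gfU ?IHk //.
  - exact: parts_between_sub.
  - by move=> l lS; apply: S1; rewrite parts_betweenS; right.
  - by rewrite -subset0 => _ [/[swap] -[l _ <-]] /andP[_ /=]; lia.
apply: (mulIr (unit_1subXn R ak0)); rewrite inv_pochSr //.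
by rewrite mulrBr mulr1 {1}recF [_ * fpsX R ^+ _]mulrC addrK.
Qed.

(** * Partitions with difference [t], by smallest part *)

Definition diff_last_ge t m : set (seq nat) :=
  [set l | [&& l != [::], sorted geq l, all (ltn 0) l,
            head 0 l - last 0 l == t & m <= last 0 l]%N].

Lemma diff_last_ge_sub t m : diff_last_ge t m `<=` positive_decreasing.
Proof. by move=> l /and5P[_ l_sorted l_pos _ _]; apply/andP. Qed.

Definition add_ends t m (l : seq nat) : seq nat := (m + t)%N :: rcons l m.

(** By transitivity, sortedness means that all pairs are ordered, so the two ends only bound the
    entries between them. *)
Lemma sorted_add_ends t m l :
  sorted geq (add_ends t m l) =
  sorted geq l && all (fun x => m <= x < m + t.+1)%N l.
Proof.
rewrite !(sorted_pairwise geq_trans) /add_ends /= pairwise_rcons all_rcons.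
rewrite /= leq_addr /= andbA andbC -all_predI; congr (_ && _).
by apply: eq_all => x /=; lia.
Qed.

(** If the smallest part is exactly [m], the largest is [m + t]. As [0 < t], these are two entries,
    and stripping them leaves arbitrary parts from [m] to [m + t]. *)
Lemma diff_last_ge_rec t m : (0 < t)%N -> (0 < m)%N ->
  diff_last_ge t m =
  diff_last_ge t m.+1 `|` add_ends t m @` parts_between m t.+1.
Proof.
move=> t0 m0; apply/seteqP; split => [l|l [|[l' l'S <-]]].
- case: l => [|x l] // /and5P[_ l_sorted l_pos /=].
  case: (ltngtP m (last x l)) => // [lt_m /eqP lt _|def_m /eqP lt _].
    by left; apply/and5P; split=> //=; apply/eqP.
  right; case/lastP: l l_sorted l_pos def_m lt => [|l y] l_sorted _ /=.
    by rewrite subnn; lia.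
  rewrite last_rcons => def_m lt.
  have def_l : x :: rcons l y = add_ends t m l.
    by rewrite /add_ends def_m -lt subnKC //; lia.
  by exists l; rewrite /parts_between /= -?sorted_add_ends -def_l.
- move=> /and5P[? ? ? ? ?]; apply/and5P; split=> //; exact: ltnW.
- apply/and5P; split=> //=.
  + by have := sorted_add_ends t m l'; rewrite /= => ->.
  + rewrite all_rcons; have /andP[_ l'_pos] := parts_between_sub m0 l'S.
    by rewrite l'_pos /=; lia.
  + by rewrite last_rcons; lia.
  + by rewrite last_rcons.
Qed.

(** This recurrence on tails stands in for the infinite sum over [m]; the exponent is the weight of
    the two ends. *)
Lemma gf_diff_last_ge (R : comUnitRingType) t m : (0 < t)%N -> (0 < m)%N ->
  gf R (diff_last_ge t m) =
  gf R (diff_last_ge t m.+1) + fpsX R ^+ (m + t + m) * inv_poch R m t.+1.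
Proof.
move=> t0 m0; have recD := diff_last_ge_rec t0 m0.
rewrite -gf_parts_between // -(@gf_image _ (add_ends t m)); first last.
- by move=> l; rewrite /= sumn_rcons; lia.
- by move=> l l' [/rcons_inj[]].
- exact: parts_between_sub.
rewrite recD gfU //; first exact: diff_last_ge_sub.
- by move=> l lS; apply: (@diff_last_ge_sub t m); rewrite recD; right.
- rewrite -subset0 => _ [/[swap] -[l _ <-]] /and5P[_ _ _ _ /=].
  by rewrite last_rcons ltnn.
Qed.

(** The last entry alone already weighs at least [m]. *)
Lemma coef_gf_diff_last_ge (R : comUnitRingType) t m n : (n < m)%N ->
  (gf R (diff_last_ge t m))``_n = 0.
Proof.
move=> lt_nm /=; rewrite [weight_class _ _](_ : _ = set0) ?fset_set0 ?cardfs0 //.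
rewrite -subset0 => l [/and5P[l0 _ _ _ le_m] /= l_n].
case/lastP: l l0 le_m l_n => // l x _; rewrite last_rcons sumn_rcons; lia.
Qed.

(** Positivity of the parts gives the bound 1 on the last one. Degree 0, set to [0] on the left, has
    an empty class on the right. *)
Lemma gf_partitions_diffE (R : comUnitRingType) t :
  gf_partitions_diff R t = gf R (diff_last_ge t 1).
Proof.
apply: fpsP => -[|n]; first by rewrite coef_gf_diff_last_ge.
rewrite /= /num_partitions_diff; congr (#|` fset_set _|)%:R.
apply/seteqP; split => l.
  move=> [/and4P[l0 l_sorted l_pos /eqP l_n] lt]; split=> //.
  apply/and5P; split=> //; first exact/eqP.
  case/lastP: l l0 l_pos {l_sorted l_n lt} => // l x _.
  by rewrite all_rcons last_rcons => /andP[].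
move=> [/and5P[l0 l_sorted l_pos /eqP lt _] /= l_n]; split=> //.
by apply/and4P; split=> //; apply/eqP.
Qed.

Local Close Scope classical_set_scope.

Theorem theorem1 (t : nat) (ht : (1 < t)%N) :
  let q : fps rat := fpsX rat in
  gf_partitions_diff rat t =
    q ^+ (t - 1) * (1 - q) / ((1 - q ^+ t) * (1 - q ^+ (t - 1)))
    - q ^+ (t - 1) * (1 - q)
        / ((1 - q ^+ t) * (1 - q ^+ (t - 1)) * qpoch q t)
    + q ^+ t / ((1 - q ^+ (t - 1)) * qpoch q t).
Proof.
move=> q; have t0 : (0 < t)%N by lia.
have s0 : (0 < t - 1)%N by lia.
have Ut : 1 - q ^+ t \is a GRing.unit by apply: unit_1subXn.
have Us : 1 - q ^+ (t - 1) \is a GRing.unit by apply: unit_1subXn.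
have qt : q ^+ t = q * q ^+ (t - 1) by rewrite -exprS subn1 prednK.
have Up : qpoch q t \is a GRing.unit by apply: unit_qpoch.
(* The telescoping conditions determine [b] through [bq], then [a] through [ab]. *)
pose b := q ^+ (t - 1) / (1 - q ^+ (t - 1)).
pose a := - (b * (1 - q) / (1 - q ^+ t)).
have ab : a * (1 - q ^+ t) + b * (1 - q) = 0 by rewrite mulNr divrK // addNr.
have bq : b * (q - q ^+ t) = q ^+ t.
  have -> : q - q ^+ t = (1 - q ^+ (t - 1)) * q by rewrite qt; ring.
  by rewrite mulrA divrK // mulrC -qt.
(* The value at [m = 1] of the tail minus [G(q^m)]; telescoping makes this difference independent of
   [m]. *)
pose c := gf rat (diff_last_ge t 1) - (a + b * q ^+ 1) * inv_poch rat 1 t.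
have c_const m : (0 < m)%N ->
    gf rat (diff_last_ge t m) - (a + b * q ^+ m) * inv_poch rat m t = c.
  elim: m => // -[_ _ //|m] IHm _; rewrite -IHm // (@gf_diff_last_ge _ t m.+1) //.
  by rewrite -(telescope_term (ltn0Sn m) ab bq); ring.
have c_a := const_tail (@coef_gf_diff_last_ge _ t) c_const.
rewrite gf_partitions_diffE.
have -> : gf rat (diff_last_ge t 1) =
    - a + (a + b * q ^+ 1) * inv_poch rat 1 t by rewrite -c_a subrK.
(* With inverses of products split, the two sides agree as polynomials in [q], [q ^+ (t - 1)] and
   three inverses. *)
rewrite qpochV !invrM ?unitrM ?Ut ?Us ?Up // /a /b expr1 qt.
ring.
Qed.
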